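(* Let $d \geq 2$ and $n \geq 2$ be integers and let $f \in \mathfrak{T}(d,n,* )$. Then $$ S(f, \mathfrak{T}(d,n,* )) = \begin{cases} E_n^d, & M_1(f) = \emptyset,\\ \textup{Vert}(P(f)) \cup D(f), & M_1(f) \neq \emptyset, \end{cases} $$ and $S(f, \mathfrak{T}(d,n,* ))$ is the unique minimal teaching set of $f$ with respect to $\mathfrak{T}(d,n,* )$.
   Context: Let $E_n^d=\{0,1,\dots,n-1\}^d$. For $f:E_n^d\to\{0,1\}$ let $M_\nu(f)=\{x\in E_n^d: f(x)=\nu\}$. A function $f:E_n^d\to\{0,1\}$ is $k$-threshold if there are real numbers $a_{ij}$ ($1\le i\le k$, $0\le j\le d$) with $M_1(f)=\{x\in E_n^d: \sum_{j=1}^d a_{ij}x_j\le a_{i0},\ i=1,\dots,k\}$; $\mathfrak{T}(d,n,k)$ is the class of $k$-threshold functions over $E_n^d$ and $\mathfrak{T}(d,n,* )=\bigcup_{k\ge1}\mathfrak{T}(d,n,k)$. For a class $\mathcal{C}$ of $\{0,1\}$-valued functions on a domain $X$ and $f\in\mathcal{C}$: a point $x\in X$ is essential for $f$ with respect to $\mathcal{C}$ if there is $g\in\mathcal{C}$ with $g(x)\ne f(x)$ and $g=f$ on $X\setminus\{x\}$; $S(f,\mathcal{C})$ is the set of essential points. A teaching set of $f$ with respect to $\mathcal{C}$ is a set $T\subseteq X$ such that the only function in $\mathcal{C}$ agreeing with $f$ on $T$ is $f$; it is minimal if no proper subset is a teaching set. $P(f)=\textup{Conv}(M_1(f))$ (convex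 hull in $\mathbb{R}^d$), $\textup{Vert}(P)$ is the vertex set of a polytope $P$, and $D(f)=\{x\in M_0(f): \textup{Conv}(P(f)\cup\{x\})\cap M_0(f)=\{x\}\}$. *)

(* Defs.v *)
From HB Require Import structures.
From mathcomp Require Import all_boot all_order all_algebra.
From mathcomp Require Import boolp classical_sets reals convex.

Set Implicit Arguments.
Unset Strict Implicit.
Unset Printing Implicit Defensive.

Import Order.TTheory GRing.Theory Num.Theory.

Local Open Scope classical_set_scope.
Local Open Scope ring_scope.

Section Teaching.
Variable X : Type.
Implicit Types (C : set (X -> bool)) (f g : X -> bool) (T U : set X).

Definition essential_point C f (x : X) : Prop :=
  exists2 g, C g & g x <> f x /\ forall y, y <> x -> g y = f y.

Definition essential_set C f : set X := [set x | essential_point C f x].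

Definition teaching_set C f T : Prop :=
  forall g, C g -> (forall x, T x -> g x = f x) -> g = f.

Definition minimal_teaching_set C f T : Prop :=
  teaching_set C f T /\ forall U, U `<` T -> ~ teaching_set C f U.

Definition unique_minimal_teaching_set C f T : Prop :=
  minimal_teaching_set C f T /\
  forall U, minimal_teaching_set C f U -> U = T.

End Teaching.

Section Polytope.
Variables (R : realType) (d : nat).
Implicit Types (A P : set 'rV[R]_d) (v : 'rV[R]_d).

Definition Conv A : set 'rV[R]_d :=
  smallest (@convex_set R 'rV[R]_d) A.

(* A vertex is a zero-dimensional face, a face being the intersection of P
   with {y | c y = c0} for some inequality c y <= c0 valid on P; c = 0 is
   allowed, so that the point of a one-point polytope is a vertex. *)
Definition Vert P : set 'rV[R]_d :=
  [set v | exists (c : 'rV[R]_d) (c0 : R),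
     (forall y, P y -> \sum_(j < d) c 0 j * y 0 j <= c0) /\
     P `&` [set y | \sum_(j < d) c 0 j * y 0 j = c0] = [set v]].

End Polytope.

Definition grid (d n : nat) := 'rV['I_n]_d.

Section Threshold.
Variables (R : realType) (d n : nat).
Implicit Types (f : grid d n -> bool) (x : grid d n).

Definition grid_embed x : 'rV[R]_d := \row_j (x 0 j : nat)%:R.

Definition M0 f : set (grid d n) := [set x | f x = false].
Definition M1 f : set (grid d n) := [set x | f x = true].

(* Column 0 of a holds the right-hand sides a_{i0}; column lift ord0 j, of
   value j + 1, holds the coefficients of the coordinate x 0 j, which is the
   (j + 1)-st one since 'I_d is numbered from 0. *)
Definition threshold (k : nat) : set (grid d n -> bool) :=
  [set f | exists a : 'M[R]_(k, d.+1),
     M1 f = [set x | forall i : 'I_k,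
       \sum_(j < d) a i (lift ord0 j) * grid_embed x 0 j <= a i ord0]].

Definition threshold_any : set (grid d n -> bool) :=
  \bigcup_(k in [set k : nat | (1 <= k)%N]) threshold k.

Definition hull f : set 'rV[R]_d := Conv (grid_embed @` M1 f).

Definition D f : set (grid d n) :=
  [set x | M0 f x /\
     Conv (hull f `|` [set grid_embed x]) `&` (grid_embed @` M0 f)
       = [set grid_embed x]].

End Threshold.

Arguments threshold R {d n} k.
Arguments threshold_any R d n : clear implicits.
Arguments hull R {d n} f.
Arguments D R {d n} f.
Arguments grid_embed R {d n} x.

(* Main.v *)
Require Import Defs.
From HB Require Import structures.
From mathcomp Require Import all_boot all_order all_algebra.
From mathcomp Require Import boolp classical_sets reals convex.
From mathcomp Require Import interval_inference ring lra.

Set Implicit Arguments.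
Unset Strict Implicit.
Unset Printing Implicit Defensive.

Import Order.TTheory GRing.Theory Num.Theory.

Local Open Scope classical_set_scope.
Local Open Scope ring_scope.

(** A boolean function on the grid is a threshold function of some order iff
    its true points are closed under convex hull within the grid: every grid
    point outside the hull of the finitely many true points is cut off by one
    inequality (Farkas' lemma). Hence flipping [f] at a single point [x] stays
    in the class iff [x] is a vertex of the hull or belongs to [D f].

    Closed sets form a convex geometry: if [f < g] are closed, then some point
    of [g] outside [f] can be added to [f] keeping it closed, and dually some
    such point can be removed from [g]. If a closed [g] agrees with [f] on the
    essential points, removal applied to [f && g <= f] shows [f <= g], and then
    extension applied to [f <= g] shows [f = g]. So the essential points form a
    teaching set, and every teaching set contains them. *)

(** * Farkas' lemma for finitely generated cones *)

Section Farkas.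
Variables (R : realFieldType) (V W : lmodType R) (p : V -> W -> R).
Hypothesis p_linearl : forall a u v w, p (a *: u + v) w = a * p u w + p v w.
Hypothesis p_linearr : forall a u w v, p v (a *: u + w) = a * p v u + p v w.
Hypothesis p_nondegenerate : forall v, v != 0 -> exists w, p v w < 0.

Fixpoint in_cone (s : seq V) (b : V) : Prop :=
  if s is a :: s' then exists2 t : R, 0 <= t & in_cone s' (b - t *: a) else b = 0.

(** Expanding a combination of the projected generators with coefficients [l_v] leaves the extra
    term [- l_v * (p v x / p a x)] times [a] for each [v]; these are nonnegative by the sign
    hypotheses, and [t] is their sum. *)
Lemma in_cone_project (x : W) (a : V) (s : seq V) (b : V) :
  p a x < 0 -> (forall v, v \in s -> 0 <= p v x) ->
  in_cone [seq v - (p v x / p a x) *: a | v <- s] b ->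
  exists2 t : R, 0 <= t & in_cone s (b - t *: a).
Proof.
move=> ax; elim: s b => [|v s IH] b sx /=.
  by move=> ->; exists 0 => //; rewrite scale0r subr0.
move=> [l l0 /IH [|t t0 bt]]; first by move=> u us; rewrite sx // inE us orbT.
have vx : 0 <= p v x by rewrite sx // mem_head.
exists (t - l * (p v x / p a x)).
  by rewrite subr_ge0 (le_trans _ t0) // mulr_ge0_le0 // mulr_ge0_le0 //
    invr_le0 ltW.
exists l => //.
rewrite (_ : b - _ - _ = b - l *: (v - (p v x / p a x) *: a) - t *: a) //.
by rewrite scalerBr scalerA scalerBl !opprB !addrA [LHS]addrAC.
Qed.

(* Induction on the number of generators: when the functional [x] obtained for
   the tail is negative on the head [a], everything is projected along [a] onto
   the kernel of [x]. *)
Lemma farkas (s : seq V) (b : V) :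
  in_cone s b \/
  exists x : W, (forall v, v \in s -> 0 <= p v x) /\ p b x < 0.
Proof.
move: {2}(size s) (erefl (size s)) => m.
elim: m s b => [|m IH] [|a s] b //=.
  have [->|/p_nondegenerate [x bx]] := eqVneq b 0; first by left.
  by right; exists x.
move=> [sm]; have [bs|[x [sx bx]]] := IH s b sm.
  by left; exists 0 => //; rewrite scale0r subr0.
have [ax|ax] := leP 0 (p a x).
  by right; exists x; split => // v; rewrite inE => /orP[/eqP ->|/sx].
have [|bs|[y [sy by0]]] := IH [seq v - (p v x / p a x) *: a | v <- s]
    (b - (p b x / p a x) *: a); first by rewrite size_map.
  have [t t0 bt] := in_cone_project ax sx bs.
  left; exists (p b x / p a x + t).
    by rewrite addr_ge0 // ltW // nmulr_rgt0 // invr_lt0.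
  by rewrite scalerDl opprD addrA.
(* The adjoint of the projection along [a] turns [y] into a functional that vanishes on [a]. *)
have projE v : p (v - (p v x / p a x) *: a) y =
    p v ((- (p a y / p a x)) *: x + y).
  rewrite p_linearr addrC -scaleNr p_linearl.
  by field; rewrite lt_eqF.
right; exists ((- (p a y / p a x)) *: x + y); split; last by rewrite -projE.
move=> v; rewrite inE => /orP[/eqP ->|vs]; last first.
  by rewrite -projE; apply/sy/mapP; exists v.
by rewrite p_linearr mulNr divfK ?lt_eqF // addNr.
Qed.

End Farkas.

(** * Convex sets in R^d and separation from a finite set *)

Section Separation.
Variables (R : realType) (d : nat).
Implicit Types (A K : set 'rV[R]_d) (c u v w : 'rV[R]_d) (s : seq 'rV[R]_d).

Definition dot u v : R := \sum_(j < d) u 0 j * v 0 j.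

Lemma dotC u v : dot u v = dot v u.
Proof. by apply: eq_bigr => j _; rewrite mulrC. Qed.

Lemma dot_linear (a : R) u v w : dot u (a *: v + w) = a * dot u v + dot u w.
Proof.
rewrite /dot mulr_sumr -big_split; apply: eq_bigr => j _ /=.
by rewrite !mxE mulrDr mulrCA.
Qed.

Lemma dotZ (a : R) u v : dot u (a *: v) = a * dot u v.
Proof.
by rewrite -[a *: v]addr0 dot_linear [X in _ + X]big1 ?addr0 // => j _;
  rewrite mxE mulr0.
Qed.

Lemma dotNl u v : dot (- u) v = - dot u v.
Proof. by rewrite -sumrN; apply: eq_bigr => j _; rewrite mxE mulNr. Qed.

Lemma dot_gt0 u : u != 0 -> 0 < dot u u.
Proof.
move=> u0; rewrite lt_def sumr_ge0 ?andbT; last first.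
  by move=> j _; rewrite -expr2 sqr_ge0.
apply: contra u0; rewrite psumr_eq0; last by move=> j _; rewrite -expr2 sqr_ge0.
move=> /allP u0; apply/eqP/rowP => j; rewrite mxE.
by have /(_ (mem_index_enum j)) := u0 j; rewrite /= mulf_eq0 orbb => /eqP.
Qed.

Lemma convex_setP A : convex_set A <->
  forall u v (t : R), 0 <= t <= 1 -> A u -> A v -> A (t *: u + (1 - t) *: v).
Proof.
split=> [cA u v t t01 Au Av|cA u v t].
  have := cA u v (Itv01 (proj1 (andP t01)) (proj2 (andP t01))).
  by rewrite !inE; apply.
rewrite !inE => Au Av; apply: cA => //.
by apply/andP; split.
Qed.

Lemma convex_Conv A : convex_set (Conv A).
Proof.
apply/convex_setP => u v t t01 Au Av K [cK AK].
by apply: (proj1 (convex_setP _) cK) => //; [apply: Au|apply: Av].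
Qed.

Lemma sub_Conv A : A `<=` Conv A.
Proof. exact: sub_gen_smallest. Qed.

Lemma Conv_sub A K : convex_set K -> A `<=` K -> Conv A `<=` K.
Proof. exact: smallest_sub. Qed.

Lemma Conv_mono A K : A `<=` K -> Conv A `<=` Conv K.
Proof.
move=> AK; apply: Conv_sub; first exact: convex_Conv.
exact: subset_trans AK (@sub_Conv K).
Qed.

Lemma convex_halfspace_le c (c0 : R) : convex_set [set u | dot c u <= c0].
Proof.
apply/convex_setP => u v t /= t01 cu cv; rewrite dot_linear dotZ; nra.
Qed.

Lemma convex_halfspace_lt c (c0 : R) : convex_set [set u | dot c u < c0].
Proof.
apply/convex_setP => u v t /= /andP[t0 t1] cu cv; rewrite dot_linear dotZ.
by have [t2|t2] := leP t (1 / 2); nra.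
Qed.

(** A hull contained in this set can meet the hyperplane through [u] only at [u]. For [c = 0] the
    set is just the point [u]. *)
Lemma convex_halfspace_lt_point c u :
  convex_set [set v | v = u \/ dot c v < dot c u].
Proof.
apply/convex_setP => v w t /= /andP[t0 t1] cv cw.
have [->|tn0] := eqVneq t 0.
  by rewrite scale0r add0r subr0 scale1r.
have [->|tn1] := eqVneq t 1.
  by rewrite subrr scale0r addr0 scale1r.
have {tn0}t0 : 0 < t by rewrite lt_def tn0.
have {tn1}t1 : t < 1 by rewrite lt_def eq_sym tn1.
case: cv cw => [->|cv] [->|cw].
- by left; rewrite -scalerDl addrCA subrr addr0 scale1r.
- by right; rewrite dot_linear dotZ; nra.
- by right; rewrite dot_linear dotZ; nra.
- by right; rewrite dot_linear dotZ; nra.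
Qed.

(** Lifting points to height 1 turns convex combinations into conical ones. *)
Let homogenize v : R^o * 'rV[R]_d := (1, v).

(** The height [t] is the sum of the coefficients: dividing by it gives a convex combination, and
    [t = 0] forces them all to vanish. *)
Lemma in_cone_convex K s (t : R) v :
  convex_set K -> (forall u, u \in s -> K u) ->
  in_cone [seq homogenize u | u <- s] (t, v) ->
  0 < t /\ K (t^-1 *: v) \/ t = 0 /\ v = 0.
Proof.
move=> /convex_setP cK; elim: s t v => [|a s IH] t v sK /=.
  by case=> -> ->; right.
case=> l l0; have l1 : l *: (1 : R^o) = l by exact: mulr1.
move=> /IH [|[tl Kv]|[tl vl]].
- by move=> u us; apply: sK; rewrite inE us orbT.
- have {}tl : 0 < t - l by move: tl; rewrite /= l1.
  have {}Kv : K ((t - l)^-1 *: (v - l *: a)).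
    by move: Kv; rewrite /= l1.
  have t0 : 0 < t by lra.
  left; split => //.
  have -> : t^-1 *: v = (l / t) *: a +
      (1 - l / t) *: ((t - l)^-1 *: (v - l *: a)).
    rewrite scalerA.
    have -> : (1 - l / t) * (t - l)^-1 = t^-1 by field; rewrite !gt_eqF.
    by rewrite scalerBr scalerA [l / t]mulrC addrCA subrr addr0.
  apply: cK => //; last by apply: sK; rewrite mem_head.
  by rewrite divr_ge0 //= ?ler_pdivrMr // ltW // mul1r -subr_gt0.
- have {}tl : t = l by move/eqP: tl; rewrite /= l1 subr_eq0 => /eqP.
  have {}vl : v = l *: a by move/eqP: vl; rewrite subr_eq0 => /eqP.
  have [l00|ln0] := eqVneq l 0; first by right; rewrite vl tl l00 scale0r.
  left; rewrite tl lt_def ln0; split => //.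
  by rewrite vl scalerA mulVf // scale1r; apply: sK; rewrite mem_head.
Qed.

(** Farkas' lemma is applied to the lifted points: a functional [(c0, c)] nonnegative on each
    [(1, v)] and negative on [(1, u)] separates with normal [- c] and bound [c0]. *)
Lemma separation s u : ~ Conv [set` s] u ->
  exists c (c0 : R), (forall v, v \in s -> dot c v <= c0) /\ c0 < dot c u.
Proof.
move=> us.
pose p (x y : R^o * 'rV[R]_d) : R := x.1 * y.1 + dot y.2 x.2.
have [||y y0|us'|[[c0 c] [sc uc]]] := @farkas R _ _ p _ _ _
    [seq homogenize v | v <- s] (homogenize u).
- by move=> a x y z; rewrite /p /= dot_linear mulrDl -mulrA mulrDr addrACA.
- move=> a x y z; rewrite /p /= dotC dot_linear ![dot z.2 _]dotC.
  by rewrite !mulrDr mulrCA addrACA.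
- exists (- y); rewrite /p /= mulrN dotNl -opprD oppr_lt0.
  have [y10|y10] := eqVneq y.1 0.
    rewrite y10 mul0r add0r dot_gt0 //; apply: contra y0 => /eqP y20.
    by rewrite [y]surjective_pairing y10 y20.
  rewrite ltr_pwDl ?sumr_ge0 //; last by move=> j _; rewrite -expr2 sqr_ge0.
  by rewrite lt_def mulf_neq0 // -expr2 sqr_ge0.
- case: us => /=; have [|[_]|[/eqP]] := in_cone_convex (@convex_Conv [set` s]) _ us'.
  + by move=> v vs; apply: sub_Conv.
  + by rewrite invr1 scale1r.
  + by rewrite oner_eq0.
exists (- c), c0.
split=> [v vs|]; rewrite dotNl.
  have := sc _ (map_f homogenize vs); rewrite /p /= mul1r; lra.
move: uc; rewrite /p /= mul1r; lra.
Qed.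

End Separation.

(** * Hull-closed sets of grid points as a convex geometry *)

Section HullClosed.
Variables (R : realType) (d n : nat).
Implicit Types (f g : grid d n -> bool) (x y z : grid d n).

Local Notation embed := (@grid_embed R d n).

Lemma grid_embed_inj : injective embed.
Proof.
move=> x y xy; apply/rowP => j; apply/val_inj/eqP.
by move/rowP: xy => /(_ j); rewrite !mxE => /eqP; rewrite eqr_nat.
Qed.

Definition hull_closed f := forall x, hull R f (embed x) -> f x.

Lemma sub_hull f x : f x -> hull R f (embed x).
Proof. by move=> fx; apply: sub_Conv; exists x. Qed.

Lemma hull_sub f K : convex_set K -> (forall x, f x -> K (embed x)) ->
  hull R f `<=` K.
Proof. by move=> cK fK; apply: Conv_sub => // _ [x fx <-]; apply: fK. Qed.

Lemma hull_sub_hull f g : (forall x, f x -> hull R g (embed x)) ->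
  hull R f `<=` hull R g.
Proof. by apply: hull_sub; apply: convex_Conv. Qed.

Lemma hull_mono f g : (forall x, f x -> g x) -> hull R f `<=` hull R g.
Proof. by move=> fg; apply: hull_sub_hull => x /fg; apply: sub_hull. Qed.

Lemma hull_separation f u : ~ hull R f u ->
  exists c (c0 : R), (forall y, f y -> dot c (embed y) <= c0) /\ c0 < dot c u.
Proof.
move=> fu; pose s := [seq embed y | y <- enum {: grid d n} & f y].
have sP y : f y -> embed y \in s.
  by move=> fy; rewrite map_f // mem_filter fy mem_enum.
have [|c [c0 [sc uc]]] := @separation R d s u.
  apply: contra_not fu; apply: Conv_mono => v /= /mapP[y].
  by rewrite mem_filter => /andP[fy _] ->; exists y.
by exists c, c0; split => // y /sP /sc.
Qed.

Lemma threshold_anyP f : threshold_any R d n f <-> hull_closed f.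
Proof.
split=> [[k _ [a fa]] x fx|cf].
  suff : M1 f x by [].
  rewrite fa => i /=.
  pose c : 'rV[R]_d := \row_j a i (lift ord0 j).
  have cE (u : 'rV[R]_d) : \sum_(j < d) a i (lift ord0 j) * u 0 j = dot c u.
    by apply: eq_bigr => j _; rewrite mxE.
  rewrite cE; apply: (hull_sub (@convex_halfspace_le _ _ c (a i ord0)) _ fx).
  by move=> y fy /=; rewrite -cE; have : M1 f y by []; rewrite fa.
(* One inequality per grid point: a separating one for false points, [0 <= 0] for true ones. *)
have /choice [F FP] x : exists b : 'rV[R]_d * R,
    (forall y, f y -> dot b.1 (embed y) <= b.2) /\
    (~~ f x -> b.2 < dot b.1 (embed x)).
  have [fx|/negP nfx] := boolP (f x).
    by exists (0, 0); split => // y _; rewrite /dot big1 // => j _;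
      rewrite mxE mul0r.
  have [c [c0 [fc xc]]] := hull_separation (contra_not (cf x) nfx).
  by exists (c, c0).
(* The extra row [None] is the vacuous inequality [0 <= 0]; it makes the number
   of rows positive even on an empty grid. *)
pose G (o : option (grid d n)) := if o is Some x then F x else (0, 0).
pose k := #|{: option (grid d n)}|.
pose b (i : 'I_k) := G (enum_val i).
exists k; first by rewrite /k /= card_option.
exists (\matrix_(i, j) if unlift ord0 j is Some j' then (b i).1 0 j' else (b i).2).
have bE i (u : 'rV[R]_d) : \sum_(j < d) (\matrix_(i, j) if unlift ord0 j is Some j'
    then (b i).1 0 j' else (b i).2) i (lift ord0 j) * u 0 j = dot (b i).1 u.
  by apply: eq_bigr => j _; rewrite mxE liftK.
apply/seteqP; split=> [x fx i|x /= xb].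
  rewrite bE mxE unlift_none /b /G; case: (enum_val i) => [z|].
    by have [+ _] := FP z; apply.
  by rewrite /dot big1 // => j _; rewrite mxE mul0r.
apply/negPn/negP => nfx; have [_ /(_ nfx)] := FP x.
have := xb (enum_rank (Some x)).
by rewrite bE mxE unlift_none /b enum_rankK /G /= leNgt => /negP.
Qed.

Definition point_add f x : grid d n -> bool := fun y => f y || (y == x).
Definition point_remove f x : grid d n -> bool := fun y => f y && (y != x).

(** Take a functional strictly larger at [x] than on [f]. Since [z] differs from [x] and lies in the
    hull of [f] and [x], it is strictly below [x] too, hence so is the whole hull of [f] and [z]. *)
Lemma anti_exchange f x z : ~ hull R f (embed x) -> z != x ->
  hull R (point_add f x) (embed z) -> ~ hull R (point_add f z) (embed x).
Proof.
move=> fx zx fxz.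
have [c [c0 [fc xc]]] := hull_separation fx.
have fcx y : f y -> dot c (embed y) < dot c (embed x).
  by move=> /fc /le_lt_trans; apply.
have zc : dot c (embed z) < dot c (embed x).
  have [|/grid_embed_inj zx'|//] := hull_sub
      (@convex_halfspace_lt_point _ _ c (embed x)) _ fxz.
    by move=> y /orP[/fcx|/eqP ->]; [right|left].
  by rewrite zx' eqxx in zx.
move=> /(hull_sub (@convex_halfspace_lt _ _ c (dot c (embed x)))) /=.
rewrite ltxx => /(_ _)/notF; apply.
by move=> y /orP[/fcx|/eqP ->].
Qed.

(** Choose [x] in [g] outside [f] for which the hull of [f] and [x] has fewest grid points. Any
    further new point [z] in that hull would generate a smaller one, missing [x] by
    anti-exchange. *)
Lemma hull_closed_extend f g x0 : hull_closed f -> hull_closed g ->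
  (forall x, f x -> g x) -> g x0 -> ~~ f x0 ->
  exists x, [/\ g x, ~~ f x & hull_closed (point_add f x)].
Proof.
move=> cf cg fg gx0 fx0.
pose H x := [set z | `[< hull R (point_add f x) (embed z) >]]%SET.
have HP x y : reflect (hull R (point_add f x) (embed y)) (y \in H x).
  by rewrite inE; apply: asboolP.
pose P := [pred x | g x && ~~ f x].
have Px0 : P x0 by rewrite /= gx0 fx0.
have [x /andP[gx fx] xmin] := arg_minnP (fun x => #|H x|) Px0.
exists x; split => // z zx; apply/negPn/negP; rewrite negb_or => /andP[fz neq_zx].
have gz : g z.
  by apply: cg; apply: (@hull_mono (point_add f x) g _ _ zx) => y /orP[/fg|/eqP ->].
have := xmin z; rewrite /= gz fz => /(_ isT); rewrite leqNgt => /negP; apply.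
apply: proper_card; apply/properP; split.
  apply/fintype.subsetP => y /HP zy; apply/HP.
  apply: (@hull_sub_hull (point_add f z) (point_add f x) _ _ zy) => w /orP[fw|/eqP -> //].
  by apply: sub_hull; rewrite /point_add fw.
exists x; first by apply/HP; apply: sub_hull; rewrite /point_add eqxx orbT.
by apply/HP/anti_exchange => // /cf; apply/negP.
Qed.

(** Extending [f] point by point inside [g] stays closed; the last point added before reaching [g]
    is the removable one. *)
Lemma hull_closed_reduce f g x0 : hull_closed f -> hull_closed g ->
  (forall x, f x -> g x) -> g x0 -> ~~ f x0 ->
  exists x, [/\ g x, ~~ f x & hull_closed (point_remove g x)].
Proof.
move: {2}(#|[pred x | g x && ~~ f x]|) (leqnn #|[pred x | g x && ~~ f x]|) => m.
elim: m f x0 => [|m IH] f x0 fm cf cg fg gx0 fx0.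
  by move: fm; rewrite leqn0 => /eqP/card0_eq /(_ x0); rewrite !inE gx0 fx0.
have [x [gx fx cfx]] := hull_closed_extend cf cg fg gx0 fx0.
have fxg y : point_add f x y -> g y by move=> /orP[/fg|/eqP ->].
have [[y gy fxy]|fxE] := pselect (exists2 y, g y & ~~ point_add f x y).
  have [|z [gz fxz cgz]] := IH (point_add f x) y _ cfx cg fxg gy fxy.
    rewrite -ltnS; apply: leq_trans fm; apply: proper_card.
    apply/properP; split; last by exists x; rewrite !inE ?gx // /point_add eqxx orbT.
    apply/fintype.subsetP => z; rewrite !inE => /andP[->]; apply: contra.
    by rewrite /point_add => ->.
  by exists z; split => //; apply: contra fxz; rewrite /point_add => ->.
exists x; split => //; congr hull_closed: cf; apply/funext => y.
rewrite /point_remove; have [->|yx] := eqVneq y x; first by rewrite (negbTE fx) andbF.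
rewrite andbT; apply/idP/idP => [/fg //|gy]; apply/negPn/negP => fy.
by apply: fxE; exists y => //; rewrite /point_add negb_or fy.
Qed.

End HullClosed.

(** * Description of the essential points and their teaching property *)

Section EssentialPoints.
Variables (R : realType) (d n : nat).
Implicit Types (f g : grid d n -> bool) (x y z : grid d n).

Local Notation embed := (@grid_embed R d n).

Lemma essential_pointP f x : essential_point (threshold_any R d n) f x <->
  hull_closed R (if f x then point_remove f x else point_add f x).
Proof.
split=> [[g /threshold_anyP cg [gx gf]]|cf].
  suff -> : (if f x then point_remove f x else point_add f x) = g by [].
  apply/funext => y; case fx: (f x); rewrite /point_remove /point_add;
    have [->|/eqP/gf ->] := eqVneq y x; rewrite ?fx ?andbF ?andbT ?orbF //=;
    by move: gx; rewrite fx; case: (g x).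
exists (if f x then point_remove f x else point_add f x).
  exact/threshold_anyP.
case fx: (f x); rewrite /point_remove /point_add eqxx ?andbF ?orbT;
  by split=> // y /eqP yx; rewrite ?yx ?(negbTE yx) ?andbT ?orbF.
Qed.

(** If [v] were not a true point, all true points would satisfy the supporting inequality strictly,
    and so would the hull, [v] included. *)
Lemma Vert_hull_sub f : Vert (hull R f) `<=` embed @` M1 f.
Proof.
move=> v [c [c0 [fc vE]]].
have [fv vc] : hull R f v /\ dot c v = c0.
  have : [set v] v by [].
  by rewrite -vE => -[].
have [//|nfv] := pselect ((embed @` M1 f) v).
suff : hull R f `<=` [set u | dot c u < c0] by move=> /(_ _ fv) /=; rewrite vc ltxx.
apply: hull_sub; first exact: convex_halfspace_lt.
move=> y fy /=; rewrite lt_def fc ?andbT; last exact: sub_hull.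
apply/eqP => yc; apply: nfv; exists y => //.
have : [set v] (embed y) by rewrite -vE; split; [apply: sub_hull|].
by [].
Qed.

(** A functional separating [x] from the other true points is maximal on the hull only at [x], so it
    exposes [x]. Conversely, an exposing functional keeps the hull of the other true points strictly
    below [x]. *)
Lemma hull_closed_remove f x : hull_closed R f -> f x ->
  hull_closed R (point_remove f x) <-> Vert (hull R f) (embed x).
Proof.
move=> cf fx; split=> [cfx|[c [c0 [fc xE]]] z fz].
  have [|c [c0 [yc xc]]] := @hull_separation R d n (point_remove f x) (embed x).
    by move=> /cfx; rewrite /point_remove eqxx andbF.
  have fc : hull R f `<=` [set v | v = embed x \/ dot c v < dot c (embed x)].
    apply: hull_sub; first exact: convex_halfspace_lt_point.
    move=> y fy /=; have [->|yx] := eqVneq y x; first by left.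
    by right; apply: le_lt_trans xc; apply: yc; rewrite /point_remove fy.
  exists c, (dot c (embed x)); split=> [u /fc [->|/ltW]//|].
  apply/seteqP; split=> [u [/fc [//|uc]]|_ ->].
    by rewrite /= -/(dot c u) => cE; rewrite cE ltxx in uc.
  by split => //; apply: sub_hull.
have xP u : hull R f u -> dot c u = c0 -> u = embed x.
  by move=> fu uc; have : [set embed x] u by rewrite -xE.
have xc : dot c (embed x) = c0.
  have : [set embed x] (embed x) by [].
  by rewrite -xE => -[].
have zc : dot c (embed z) < c0.
  apply: (hull_sub (@convex_halfspace_lt _ _ c c0) _ fz) => y /andP[fy yx] /=.
  rewrite lt_def fc ?andbT; last exact: sub_hull.
  apply: contra yx => /eqP yc; apply/eqP/(@grid_embed_inj R d n)/xP => //.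
  exact: sub_hull.
rewrite /point_remove cf; last by apply: hull_mono fz => y /andP[].
by apply: contraTneq zc => ->; rewrite xc ltxx.
Qed.

Lemma hull_point_add f x :
  hull R (point_add f x) = Conv (hull R f `|` [set embed x]).
Proof.
apply/seteqP; split.
  apply: hull_sub; first exact: convex_Conv.
  by move=> y /orP[fy|/eqP ->]; apply: sub_Conv; [left; apply: sub_hull|right].
apply: Conv_sub; first exact: convex_Conv.
move=> u [|->]; last by apply: sub_hull; rewrite /point_add eqxx orbT.
by apply: hull_mono => y fy; rewrite /point_add fy.
Qed.

Lemma hull_closed_add f x : ~~ f x ->
  hull_closed R (point_add f x) <-> D R f x.
Proof.
move=> /negbTE fx; split=> [cfx|[_ xE] z].
  split=> //; rewrite -hull_point_add; apply/seteqP; split=> [u [fu [z fz zu]]|_ ->].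
    move: fu; rewrite -zu => /cfx; rewrite /point_add.
    have -> : f z = false := fz.
    by move=> /eqP ->.
  by split; [apply: sub_hull; rewrite /point_add eqxx orbT|exists x].
rewrite hull_point_add /point_add => xz; case fz: (f z) => //=.
suff : [set embed x] (embed z) by move=> /grid_embed_inj ->.
by rewrite -xE; split => //; exists z.
Qed.

Lemma essential_set_hull f : hull_closed R f ->
  embed @` essential_set (threshold_any R d n) f =
  Vert (hull R f) `|` embed @` D R f.
Proof.
move=> cf; apply/seteqP; split=> [_ [x /essential_pointP + <-]|u [uV|[x xD <-]]].
- case: ifPn => fx; first by move/(hull_closed_remove cf fx); left.
  by move/(hull_closed_add fx) => xD; right; exists x.
- have [x fx xu] := Vert_hull_sub uV; exists x => //; apply/essential_pointP.
  have -> : f x = true := fx.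
  by apply/(hull_closed_remove cf fx); rewrite xu.
- exists x => //; apply/essential_pointP.
  have fx : f x = false by case: xD.
  by rewrite fx; apply/hull_closed_add => //; rewrite fx.
Qed.

Lemma essential_set_M1_0 f : M1 f = set0 ->
  essential_set (threshold_any R d n) f = setT.
Proof.
move=> f0; have fF x : f x = false.
  by apply/negbTE/negP => fx; have : M1 f x by []; rewrite f0.
apply/seteqP; split=> // x _; apply/essential_pointP; rewrite fF => z xz.
rewrite /point_add fF /=; apply/eqP/(@grid_embed_inj R d n).
(* With the zero functional the strict alternative is void, leaving only the point [x]. *)
have [|//|] := hull_sub (@convex_halfspace_lt_point _ _ 0 (embed x)) _ xz.
  by move=> y; rewrite /point_add fF => /eqP ->; left.
by rewrite /dot !big1 ?ltxx // => j _; rewrite mxE mul0r.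
Qed.

Lemma essential_set_sub_teaching (X : Type) (C : set (X -> bool)) h T :
  teaching_set C h T -> essential_set C h `<=` T.
Proof.
move=> Tt x [g Cg [gx gh]]; have [//|nTx] := pselect (T x).
case: gx; rewrite (Tt g) // => y Ty; apply: gh => yx.
by apply: nTx; rewrite -yx.
Qed.

Lemma essential_set_teaching f : hull_closed R f ->
  teaching_set (threshold_any R d n) f (essential_set (threshold_any R d n) f).
Proof.
move=> cf g /threshold_anyP cg gf.
have fg x0 : f x0 -> g x0.
  move=> fx0; apply/negPn/negP => gx0.
  (* A point removable from [f] outside [h] is essential for [f], yet [g] differs from [f] there. *)
  pose h x := f x && g x.
  have ch : hull_closed R h.
    move=> x hx; apply/andP; split; [apply: cf|apply: cg];
      by apply: hull_mono hx => y /andP[].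
  have [||x [fx hx cx]] := @hull_closed_reduce R d n h f x0 ch cf _ fx0.
  - by move=> x /andP[].
  - by rewrite /h (negbTE gx0) andbF.
  move: hx; rewrite /h fx gf ?fx //; apply/essential_pointP.
  by rewrite fx.
apply/funext => x0; apply/idP/idP => [gx0|/fg //]; apply/negPn/negP => fx0.
have [x [gx fx cx]] := hull_closed_extend cf cg fg gx0 fx0.
move: (fx); rewrite -gf ?gx //; apply/essential_pointP.
by rewrite (negbTE fx).
Qed.

End EssentialPoints.

(* The second identity is between subsets of R^d: the essential set, embedded
   in R^d, is the union of the vertex set and of the embedded D(f). *)
Theorem theorem1 (R : realType) (d n : nat) (hd : (2 <= d)%N) (hn : (2 <= n)%N)
    (f : grid d n -> bool) (hf : threshold_any R d n f) :
  let S := essential_set (threshold_any R d n) f in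
  [/\ M1 f = set0 -> S = setT,
      M1 f <> set0 ->
        grid_embed R @` S = Vert (hull R f) `|` grid_embed R @` D R f
    & unique_minimal_teaching_set (threshold_any R d n) f S].
Proof.
move/threshold_anyP: hf => cf S; split.
- exact: essential_set_M1_0.
- by move=> _; apply: essential_set_hull.
have tS := essential_set_teaching cf.
split=> [|U [tU Umin]].
  by split=> // U [_ nSU] /essential_set_sub_teaching.
apply/seteqP; split; last exact: essential_set_sub_teaching.
(* Otherwise [S] is a teaching set strictly inside [U], against the minimality of [U]. *)
have [//|nUS] := pselect (U `<=` S).
by case: (Umin S) => //; split=> //; apply: essential_set_sub_teaching.
Qed.
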